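(* COLOR-DISCREPANCY can be solved exactly by a one-pass deterministic streaming algorithm using $O(1)$ space when the stream $\mathcal{P}$ arrives in sorted order.
   Context: COLOR-DISCREPANCY: given a stream $\mathcal{P}$ of $n$ points in $[0,1]$, each labeled red or blue, report the 1-dimensional color discrepancy $$D_c(\mathcal{P}) := \sup_{I\subseteq[0,1]} |R(I)-B(I)|,$$ where $I$ ranges over intervals and $R(I)$, $B(I)$ denote the numbers of red and blue points of $\mathcal{P}$ in $I$. Sorted order means that the points arrive in increasing order of their values. A one-pass (insertion-only) streaming algorithm reads the points once in order and keeps only a sketch in memory. Space is counted in words, where a word can hold a point, any input parameter, and a $\lceil \log n\rceil$-bit counter. *)

(* Defs.v *)
From HB Require Import structures.
From mathcomp Require Import all_boot all_order all_algebra.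
From mathcomp Require Import classical_sets reals.

Set Implicit Arguments.
Unset Strict Implicit.
Unset Printing Implicit Defensive.

Import Order.TTheory GRing.Theory Num.Theory.

(** * Colour discrepancy *)

(* A coloured point is (x, true) when red and (x, false) when blue.  A stream
   is a sequence, so several of its points may have the same value. *)
Section Discrepancy.
Variable R : realType.
Local Open Scope ring_scope.
Local Open Scope classical_set_scope.

Definition red_count (P : seq (R * bool)) (I : interval R) : nat :=
  count (fun q => (q.1 \in I) && q.2) P.

Definition blue_count (P : seq (R * bool)) (I : interval R) : nat :=
  count (fun q => (q.1 \in I) && ~~ q.2) P.

(* [interval R] comprises the open, closed, half-open, degenerate and empty
   intervals. *)
Definition color_discrepancy (P : seq (R * bool)) : R :=
  sup [set `|(red_count P I)%:R - (blue_count P I)%:R|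
      | I in [set I : interval R | [set` I] `<=` [set` `[0%R, 1%R]%R]]].

End Discrepancy.

(** * Streaming algorithms with a memory of [s] words

    An algorithm is a finite program over [s] words, fixed once and for all: it
    depends neither on the stream nor on its length.  Points are atomic: they
    can only be copied and compared, so a word holding a point always holds a
    point of the stream that has already been read, and cannot be used to encode
    other data in a real number. *)

Inductive word (T : Type) : Type :=
| Point of T
| Counter of nat.
Arguments Counter {T}.

(* Expressions are evaluated exactly.  An expression is part of the program, so
   its value has [O(w)] bits when the words have [w] bits. *)
Inductive expr (s : nat) : Type :=
| Lit of nat
| Val of 'I_s
| Add of expr s & expr s
| Sub of expr s & expr s
| Mul of expr s & expr s
| Div of expr s & expr s.

Inductive test (s : nat) : Type :=
| ExprLt of expr s & expr s
| PointLt of 'I_s & 'I_s.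

Inductive cmd (s : nat) : Type :=
| Skip
| Copy of 'I_s & 'I_s
| Assign of 'I_s & expr s
| Seq of cmd s & cmd s
| If of test s & cmd s & cmd s
| While of test s & cmd s.
Arguments Skip {s}.

(* [on_item] is executed once for each item of the stream, after the point and
   its colour have been loaded into the words [in_point] and [in_color];
   [on_end] is executed at the end of the stream.  The input words are part of
   the memory.  The answer is the value of [answer] and is not stored. *)
Record algorithm (s : nat) : Type := Algorithm {
  in_point : 'I_s;
  in_color : 'I_s;
  on_item : cmd s;
  on_end : cmd s;
  answer : expr s
}.

Section Semantics.
Variables (R : realType) (s : nat).

Definition memory := 'I_s -> word R.

Definition update (m : memory) (i : 'I_s) (w : word R) : memory :=
  fun j => if j == i then w else m j.

(* The subtraction is truncated. *)
Fixpoint eval (m : memory) (e : expr s) : nat :=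
  match e with
  | Lit k => k
  | Val i => if m i is Counter v then v else 0
  | Add e1 e2 => eval m e1 + eval m e2
  | Sub e1 e2 => eval m e1 - eval m e2
  | Mul e1 e2 => eval m e1 * eval m e2
  | Div e1 e2 => eval m e1 %/ eval m e2
  end.

Definition holds (m : memory) (t : test s) : bool :=
  match t with
  | ExprLt e1 e2 => eval m e1 < eval m e2
  | PointLt i j =>
      match m i, m j with
      | Point x, Point y => (x < y)%R
      | _, _ => false
      end
  end.

(* [exec b c m m'] : run from the memory [m], the command [c] terminates in the
   memory [m'], and all counters stored on the way have at most [b] bits.  A
   counter overflow blocks the execution. *)
Inductive exec (b : nat) : cmd s -> memory -> memory -> Prop :=
| exec_skip m : exec b Skip m m
| exec_copy m i j : exec b (Copy i j) m (update m i (m j))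
| exec_assign m i e : eval m e < 2 ^ b ->
    exec b (Assign i e) m (update m i (Counter (eval m e)))
| exec_seq c1 c2 m1 m2 m3 :
    exec b c1 m1 m2 -> exec b c2 m2 m3 -> exec b (Seq c1 c2) m1 m3
| exec_if t c1 c2 m m' :
    exec b (if holds m t then c1 else c2) m m' -> exec b (If t c1 c2) m m'
| exec_while_done t c m : ~~ holds m t -> exec b (While t c) m m
| exec_while_step t c m1 m2 m3 : holds m1 t ->
    exec b c m1 m2 -> exec b (While t c) m2 m3 -> exec b (While t c) m1 m3.

Definition load (A : algorithm s) (m : memory) (q : R * bool) : memory :=
  update (update m (in_point A) (Point q.1)) (in_color A) (Counter q.2).

Inductive reads (b : nat) (A : algorithm s) :
  seq (R * bool) -> memory -> memory -> Prop :=
| reads_nil m : reads b A [::] m m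
| reads_cons q P m1 m2 m3 :
    exec b (on_item A) (load A m1 q) m2 -> reads b A P m2 m3 ->
    reads b A (q :: P) m1 m3.

Definition init_memory : memory := fun _ => Counter 0.

(* The one-pass run of [A] on [P] with [b]-bit counters returns [v]. *)
Definition returns (b : nat) (A : algorithm s) (P : seq (R * bool)) (v : nat) :
    Prop :=
  exists m1 m2 : memory,
    [/\ reads b A P init_memory m1, exec b (on_end A) m1 m2
      & v = eval m2 (answer A)].

Lemma exec_deterministic b c m m1 m2 :
  exec b c m m1 -> exec b c m m2 -> m1 = m2.
Proof.
move=> H; elim: H m2 => {c m m1}.
- by move=> m m2 H; inversion H.
- by move=> m i j m2 H; inversion H.
- by move=> m i e _ m2 H; inversion H.
- move=> c1 c2 m1 m2 m3 _ IH1 _ IH2 m4 H.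
  inversion H as [| | |? ? ? m2' ? e1 e2| | |]; subst.
  by apply: IH2; rewrite (IH1 _ e1).
- by move=> t c1 c2 m m' _ IH m2 H; inversion H; subst; exact: IH.
- move=> t c m /negbTE ht m2 H.
  by inversion H as [| | | | |? ? ? h|? ? ? ? ? h]; subst; rewrite ?ht in h *.
- move=> t c m1 m2 m3 ht _ IH1 _ IH2 m4 H.
  inversion H as [| | | | |? ? ? h|? ? ? m2' ? h e1 e2]; subst.
    by rewrite ht in h.
  by apply: IH2; rewrite (IH1 _ e1).
Qed.

Lemma returns_deterministic b A P v1 v2 :
  returns b A P v1 -> returns b A P v2 -> v1 = v2.
Proof.
move=> [m1 [m2 [r1 e1 ->]]] [m1' [m2' [r2 e2 ->]]].
suff E : m1 = m1' by rewrite -E in e2; rewrite (exec_deterministic e1 e2).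
move: r1 r2 {e1 e2}; move: (init_memory) => m0 r1; elim: r1 m1' => {P m0 m1}.
  by move=> m m1' H; inversion H.
move=> q P m0 m1 m3 e _ IH m4 H; inversion H as [|? ? ? m1' ? e' r]; subst.
by apply: IH; rewrite (exec_deterministic e e').
Qed.

End Semantics.

(* The number of bits of a counter word for a stream of [n] points:
   [ceil (log2 n)], but at least one bit when [n <= 1]. *)
Definition counter_bits (n : nat) : nat := maxn 1 (up_log 2 n).

Definition solves (R : realType) (s : nat) (A : algorithm s)
    (P : seq (R * bool)) : Prop :=
  exists2 v : nat, returns (counter_bits (size P)) A P v
    & (v%:R = color_discrepancy P :> R)%R.

(* Main.v *)
(* Let S be the red-minus-blue excess of the points below a threshold.  The
   colour discrepancy is M - m, where M and m are the maximum and minimum of S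
   over all thresholds.  Points with equal values cannot be separated, so in
   sorted order the extremes are updated once per group of equal values.  Only
   M - S and S - m, taken over the completed groups, and the two colour counts
   of the current group are stored; if a group has excess d, then M - S becomes
   max (M - S - d) 0, which truncated subtraction computes, and likewise for
   S - m.
   A counter of [ceil (log2 n)] bits need not hold the value n, so the counts
   lag one item behind the stream: the colour of the last item is kept apart
   and enters the count only when the next item arrives, or in the answer,
   which is not stored. *)
Require Import Defs.
From mathcomp Require Import all_boot all_order all_algebra.
From mathcomp Require Import classical_sets reals.
From mathcomp Require Import zify ring.

Set Implicit Arguments.
Unset Strict Implicit.
Unset Printing Implicit Defensive.

Import Order.TTheory GRing.Theory Num.Theory.

(** * Colour excess of intervals and prefixes *)

Section Excess.
Variable R : realType.
Implicit Types (P Q G : seq (R * bool)) (I : interval R) (c : itv_bound R).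
Local Open Scope ring_scope.

Definition excess P I : int := (red_count P I)%:Z - (blue_count P I)%:Z.

(** A threshold is an interval bound rather than a real, so it can lie just before or just after all
    points of one value. *)
Definition prefix_excess P c : int := excess P (Interval -oo%O c).

Definition total_excess P : int :=
  (count snd P)%:Z - (count (fun q => ~~ q.2) P)%:Z.

Definition prefix_range P (M m : int) : Prop :=
  [/\ forall c, m <= prefix_excess P c <= M,
      exists c, prefix_excess P c = M
    & exists c, prefix_excess P c = m].

Lemma excess_cat P Q I : excess (P ++ Q) I = excess P I + excess Q I.
Proof. by rewrite /excess /red_count /blue_count !count_cat; lia. Qed.

Lemma total_excess_cat P Q :
  total_excess (P ++ Q) = total_excess P + total_excess Q.
Proof. by rewrite /total_excess !count_cat; lia. Qed.

Lemma excess_cons q P I :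
  excess (q :: P) I = (if q.1 \in I then (-1) ^+ (~~ q.2) else 0) + excess P I.
Proof.
rewrite /excess /red_count /blue_count /= !PoszD.
by case: (q.1 \in I); case: q.2; rewrite /= ?expr0 ?expr1; ring.
Qed.

Lemma eq_excess P I J :
  {in P, forall q, (q.1 \in I) = (q.1 \in J)} -> excess P I = excess P J.
Proof.
move=> eqIJ; congr (_%:Z - _%:Z); apply: eq_in_count => q qP;
  by rewrite eqIJ.
Qed.

Lemma excess_all P I :
  {in P, forall q, q.1 \in I} -> excess P I = total_excess P.
Proof.
by move=> PI; congr (_%:Z - _%:Z); apply: eq_in_count => q qP; rewrite PI.
Qed.

Lemma excess_none P I : {in P, forall q, q.1 \notin I} -> excess P I = 0.
Proof.
move=> PI; rewrite /excess /red_count /blue_count.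
by rewrite !(@eq_in_count _ _ pred0) ?count_pred0 // => q qP;
  rewrite (negbTE (PI q qP)).
Qed.

Lemma mem_Iic (x : R) c : (x \in Interval -oo%O c) = (BRight x <= c)%O.
Proof. by rewrite itv_boundlr. Qed.

Lemma prefix_excess_diff P (c d : itv_bound R) : (c <= d)%O ->
  prefix_excess P d - prefix_excess P c = excess P (Interval c d).
Proof.
move=> cd.
have memE (x : R) :
    (x \in Interval c d) = (BRight x <= d)%O && ~~ (BRight x <= c)%O.
  by rewrite itv_boundlr andbC -ltNge; case: c {cd} => [[] y|[]].
rewrite /prefix_excess; elim: P => [//|q P IH].
rewrite !excess_cons memE !mem_Iic -IH.
have [qc|qc] := boolP (BRight q.1 <= c)%O.
  by rewrite (le_trans qc cd); ring.
by rewrite andbT; ring.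
Qed.

Lemma prefix_excess_lt P (x : R) c : (c <= BLeft x)%O ->
  {in P, forall q, q.1 = x} -> prefix_excess P c = 0.
Proof.
move=> cx Px; apply: excess_none => q /Px ->.
by rewrite mem_Iic -ltNge (le_lt_trans cx) // bnd_simp.
Qed.

Lemma prefix_range_nil : prefix_range [::] 0 0.
Proof.
split=> [c||]; [|by exists -oo%O|by exists -oo%O].
by rewrite [prefix_excess _ _]subrr lexx.
Qed.

(** A threshold at or below [BLeft x] sees only [Q], and one at or above [BRight x] sees everything.
    Hence the group [G] contributes the single new value [S]. *)
Lemma prefix_range_cat Q G (x : R) (M m : int) :
  {in Q, forall q, q.1 < x} -> {in G, forall q, q.1 = x} ->
  prefix_range Q M m ->
  let S := total_excess Q + total_excess G in
  prefix_range (Q ++ G) (Num.max M S) (Num.min m S).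
Proof.
move=> Qx Gx [bnd [cM EM] [cm Em]] S.
have lowE c :
    prefix_excess (Q ++ G) (Order.min c (BLeft x)) = prefix_excess Q c.
  rewrite /prefix_excess excess_cat [X in _ + X](prefix_excess_lt _ Gx).
    rewrite addr0; apply: eq_excess => q /Qx qx.
    by rewrite !mem_Iic le_min bnd_simp qx andbT.
  by rewrite ge_min lexx orbT.
have topE c : (BRight x <= c)%O -> prefix_excess (Q ++ G) c = S.
  move=> xc; rewrite /prefix_excess excess_cat !excess_all // => q.
    by move=> /Gx ->; rewrite mem_Iic.
  by move=> /Qx qx; rewrite mem_Iic (le_trans _ xc) // bnd_simp ltW.
split.
- move=> c; have [xc|cx] := leP (BRight x) c.
    by rewrite topE //; lia.
  (* No bound lies strictly between [BLeft x] and [BRight x]. *)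
  have -> : c = Order.min c (BLeft x).
    by apply/esym/min_idPl; case: c cx => [[] y|[]].
  by rewrite lowE; have := bnd c; lia.
- have [MS|SM] := leP M S; last first.
    by exists (Order.min cM (BLeft x)); rewrite lowE.
  by exists (BRight x); rewrite topE.
- have [mS|Sm] := leP m S.
    by exists (Order.min cm (BLeft x)); rewrite lowE.
  by exists (BRight x); rewrite topE.
Qed.

(** An interval is a difference of two prefixes, so its excess is at most [M - m] in absolute value.
    Equality holds between two thresholds attaining [M] and [m], in whichever order they come. *)
Lemma color_discrepancy_prefix_range P (M m : int) :
  {in P, forall q, 0 <= q.1 <= 1} -> prefix_range P M m ->
  color_discrepancy P = (M - m)%:~R.
Proof.
move=> P01 [bnd [cM EM] [cm Em]].
have absE I : `|(red_count P I)%:R - (blue_count P I)%:R| =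
    `|excess P I|%:~R :> R.
  by rewrite intr_norm rmorphB.
(* All points lie in [[0, 1]], so an optimal interval can be cut down to a subset of it. *)
have in01 I : excess P (Order.meet I `[0, 1]) = excess P I.
  apply: eq_excess => q /P01 q01.
  by rewrite in_itvI [X in _ && X]in_itv /= q01 andbT.
have [I [I01 EI]] : exists I, ([set` I] `<=` [set` `[0%R, 1%R]%R])%classic
    /\ `|excess P I| = M - m.
  have mM : m <= M by have := bnd cM; lia.
  have [c [d [cd E]]] : exists c d, (c <= d)%O /\
      `|prefix_excess P d - prefix_excess P c| = M - m.
    have [h|h] := leP cm cM; [exists cm, cM|exists cM, cm]; rewrite EM Em.
      by split=> //; lia.
    by split; [exact: ltW|lia].
  exists (Order.meet (Interval c d) `[0, 1]); split.
    by move=> x /=; rewrite in_itvI => /andP[].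
  by rewrite in01 -prefix_excess_diff.
have ub J : `|excess P J| <= M - m.
  case: J => c d; have [cd|dc] := leP c d.
    by rewrite -prefix_excess_diff //; have := bnd c; have := bnd d; lia.
  rewrite excess_none; first by have := bnd c; lia.
  move=> q _; rewrite itv_boundlr; apply/negP => /andP[h1 h2].
  have := lt_le_trans dc (le_trans h1 (le_trans _ h2)).
  by rewrite ltxx bnd_simp lexx => /(_ isT).
rewrite /color_discrepancy; set A := (X in sup X).
have AD : A (M - m)%:~R by exists I => //; rewrite absE EI.
have ubA : ubound A (M - m)%:~R.
  by move=> _ [J _ <-]; rewrite absE ler_int.
apply/le_anti/andP; split.
  by apply: ge_sup => //; exists (M - m)%:~R.
by apply: ub_le_sup => //; exists (M - m)%:~R.
Qed.

End Excess.

(** * The program with nine words and its invariant *)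

Section Algorithm.
Variable R : realType.
Implicit Types (P Q G : seq (R * bool)) (m : memory R 9) (q : R * bool).

Local Notation word_ k := (@Ordinal 9 k isT).

Definition cur_point : 'I_9 := word_ 0.
Definition cur_color : 'I_9 := word_ 1.
Definition last_point : 'I_9 := word_ 2.
(** The colour of the last item takes two 0/1 counters instead of one, so that the initial zeros
    mean that no item is pending. *)
Definition last_red : 'I_9 := word_ 3.
Definition last_blue : 'I_9 := word_ 4.
Definition group_red : 'I_9 := word_ 5.
Definition group_blue : 'I_9 := word_ 6.
(* With S the excess of the completed groups, these two hold M - S and S - m. *)
Definition drop_from_max : 'I_9 := word_ 7.
Definition rise_from_min : 'I_9 := word_ 8.

Definition incr_by (i j : 'I_9) : cmd 9 := Assign i (Add (Val i) (Val j)).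

(** Each addition precedes the subtraction, so that truncation applies only to the final
    difference. *)
Definition close_group : cmd 9 :=
  Seq (Assign drop_from_max
        (Defs.Sub (Add (Val drop_from_max) (Val group_blue)) (Val group_red)))
  (Seq (Assign rise_from_min
        (Defs.Sub (Add (Val rise_from_min) (Val group_red)) (Val group_blue)))
  (Seq (Assign group_red (Lit _ 0)) (Assign group_blue (Lit _ 0)))).

Definition process_item : cmd 9 :=
  Seq (incr_by group_red last_red)
  (Seq (incr_by group_blue last_blue)
  (Seq (If (PointLt last_point cur_point) close_group Skip)
  (Seq (Copy last_point cur_point)
  (Seq (Copy last_red cur_color)
       (Assign last_blue (Defs.Sub (Lit _ 1) (Val cur_color))))))).

(* The last two summands are the amounts by which the unfinished group raises M
   and lowers m; at most one of them is nonzero. *)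
Definition range_answer : expr 9 :=
  let red := Add (Val group_red) (Val last_red) in
  let blue := Add (Val group_blue) (Val last_blue) in
  Add (Add (Val drop_from_max) (Val rise_from_min))
    (Add (Defs.Sub red (Add blue (Val drop_from_max)))
         (Defs.Sub blue (Add red (Val rise_from_min)))).

Definition discrepancy_algorithm : algorithm 9 :=
  Algorithm cur_point cur_color process_item Skip range_answer.

Definition counters m : seq (word R) :=
  [seq m i | i <- [:: last_red; last_blue; group_red; group_blue;
                      drop_from_max; rise_from_min]].

Definition starts_group m (x : R) : bool :=
  if m last_point is Point y then (y < x)%R else false.

(** The two sums dominate every group count and range counter stored on the way; [0 < k] leaves room
    for the colour bits. *)
Lemma exec_process_item k m q (lr lb r b u w : nat) :
  counters m = [seq Counter v | v <- [:: lr; lb; r; b; u; w]] ->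
  0 < k -> u + (r + b) + (lr + lb) < 2 ^ k -> w + (r + b) + (lr + lb) < 2 ^ k ->
  exists m', [/\ exec k process_item (load discrepancy_algorithm m q) m',
    m' last_point = Point q.1
  & counters m' = [seq Counter v | v <- if starts_group m q.1 then
      [:: nat_of_bool q.2; nat_of_bool (~~ q.2); 0; 0;
          u + (b + lb) - (r + lr); w + (r + lr) - (b + lb)]
      else [:: nat_of_bool q.2; nat_of_bool (~~ q.2); r + lr; b + lb; u; w]]].
Proof.
move=> [Elr Elb Er Eb Eu Ew] k0 bu bw.
have two_le : 2 <= 2 ^ k by rewrite -{1}(expn1 2) leq_exp2l.
have holdsE m1 : m1 last_point = m last_point -> m1 cur_point = Point q.1 ->
    holds m1 (PointLt last_point cur_point) = starts_group m q.1.
  by rewrite /= /starts_group => -> ->; case: (m last_point).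
have colorE : 1 - q.2 = ~~ q.2 :> nat by case: q.2.
case: (boolP (starts_group m q.1)) => sg; eexists; split.
- apply: exec_seq; first by
    apply: exec_assign; rewrite /= /load /update /= Er Elr; lia.
  apply: exec_seq; first by
    apply: exec_assign; rewrite /= /load /update /= Eb Elb; lia.
  apply: exec_seq.
    apply: exec_if; rewrite holdsE // sg.
    apply: exec_seq; first by
      apply: exec_assign; rewrite /= /load /update /= Er Elr Eb Elb Eu; lia.
    apply: exec_seq; first by
      apply: exec_assign; rewrite /= /load /update /= Er Elr Eb Elb Ew; lia.
    by apply: exec_seq; apply: exec_assign; rewrite /= expn_gt0.
  apply: exec_seq; first exact: exec_copy.
  apply: exec_seq; first exact: exec_copy.
  by apply: exec_assign; rewrite /= /load /update /= colorE; case: q.2; lia.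
- by [].
- by rewrite /counters /= /load /update /= Er Elr Eb Elb Eu Ew colorE.
- apply: exec_seq; first by
    apply: exec_assign; rewrite /= /load /update /= Er Elr; lia.
  apply: exec_seq; first by
    apply: exec_assign; rewrite /= /load /update /= Eb Elb; lia.
  apply: exec_seq; first by
    apply: exec_if; rewrite holdsE // (negbTE sg); exact: exec_skip.
  apply: exec_seq; first exact: exec_copy.
  apply: exec_seq; first exact: exec_copy.
  by apply: exec_assign; rewrite /= /load /update /= colorE; case: q.2; lia.
- by [].
- by rewrite /counters /= /load /update /= Er Elr Eb Elb Eu Ew colorE.
Qed.

(** [Q] holds the completed groups and [G] the current one, whose counts [r] and [b] lack the
    pending item [lr], [lb]. [G] is nonempty so that the stored point is the value of an item of
    [P]. *)
Definition invariant P m : Prop :=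
  exists Q G, exists lr lb r b u w : nat,
  [/\ P = Q ++ G,
      if m last_point is Point x then
        [/\ {in Q, forall q, (q.1 < x)%R}, {in G, forall q, q.1 = x}
          & G != [::]]
      else P = [::],
      counters m = [seq Counter v | v <- [:: lr; lb; r; b; u; w]],
      u + (r + b) + (lr + lb) <= size P /\ w + (r + b) + (lr + lb) <= size P
    & [/\ r + lr = count snd G, b + lb = count (fun q => ~~ q.2) G
      & prefix_range Q (total_excess Q + u%:Z)%R (total_excess Q - w%:Z)%R]].

Lemma invariant_init : invariant [::] (@init_memory R 9).
Proof.
exists [::], [::], 0, 0, 0, 0, 0, 0; split=> //; split=> //.
exact: prefix_range_nil.
Qed.

(** Apart from the colour bits of [q], the counters written while [q] is read concern only the items
    of [P]. So a strict bound on [size P] suffices, and the full stream may have [2 ^ k] items. *)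
Lemma invariant_step k P q m : 0 < k -> size P < 2 ^ k ->
  {in P, forall p, (p.1 <= q.1)%R} -> invariant P m ->
  exists2 m', exec k process_item (load discrepancy_algorithm m q) m'
    & invariant (rcons P q) m'.
Proof.
move=> k0 Pk Pq [Q [G [lr [lb [r [b [u [w inv]]]]]]]].
case: inv => EP last_m cnt [bu bw] [Er Eb QR].
have [||m' [ex last' cnt']] := exec_process_item q cnt k0; try lia.
exists m' => //; rewrite /invariant last' size_rcons.
case: (boolP (starts_group m q.1)) cnt' => sg cnt'.
  (* The old group is closed: all of [P] is completed, and [q] alone is current. *)
  exists P, [:: q], q.2, (~~ q.2), 0, 0, (u + (b + lb) - (r + lr)),
    (w + (r + lr) - (b + lb)).
  move: sg last_m; rewrite /starts_group.
  case: (m last_point) => // x xq [Qx Gx _].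
  split; rewrite ?cats1 //.
  - split=> // p; last by rewrite inE => /eqP ->.
    by rewrite EP mem_cat => /orP[/Qx/lt_trans->//|/Gx->].
  - by case: q.2; lia.
  split; rewrite /= ?addn0 ?add0n //.
  have := prefix_range_cat Qx Gx QR; rewrite /= -EP.
  rewrite -total_excess_cat -EP.
  (* Once [S] is the old excess plus that of [G], the new maximum minus [S] is exactly the truncated
     difference stored by the program. *)
  have : total_excess P = (total_excess Q + ((r + lr)%:Z - (b + lb)%:Z))%R.
    by rewrite EP total_excess_cat Er Eb.
  move: (total_excess P) (total_excess Q) => S T ES.
  by congr prefix_range; lia.
exists Q, (rcons G q), q.2, (~~ q.2), (r + lr), (b + lb), u, w.
split=> //.
- by rewrite EP rcons_cat.
- move: sg last_m; rewrite /starts_group; case: (m last_point) => [x|v].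
    rewrite -leNgt => qx [Qx Gx Gn].
    (* Sortedness against any item of [G] gives [x <= q.1]; the failed test gives the converse. *)
    have qx1 : q.1 = x.
      case: (G) Gn Gx EP => // p G1 _ Gx1 EP; apply/le_anti; rewrite qx.
      by rewrite -(Gx1 p) ?mem_head // Pq // EP mem_cat mem_head orbT.
    rewrite qx1; split=> // [p|]; last by case: (G).
    by rewrite mem_rcons inE => /orP[/eqP ->|/Gx].
  move=> _ P0; move: EP; rewrite P0; case: (Q) (G) => // [[|//]] _.
  by split=> // p; rewrite inE => /eqP ->.
- by case: q.2; lia.
- split=> //; rewrite -cats1 count_cat /=; lia.
Qed.

Lemma reads_invariant k P Q m : 0 < k -> size (P ++ Q) <= 2 ^ k ->
  sorted <=%R [seq q.1 | q <- P ++ Q] -> invariant P m ->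
  exists2 m', reads k discrepancy_algorithm Q m m' & invariant (P ++ Q) m'.
Proof.
move=> k0; elim: Q P m => [|q Q IH] P m.
  by rewrite cats0 => *; exists m => //; exact: reads_nil.
rewrite size_cat /= => szPQ srt inv.
have [|p pP|m1 ex1 inv1] := invariant_step (q := q) k0 _ _ inv; first by lia.
  move: srt; rewrite map_cat sorted_pairwise; last exact: le_trans.
  rewrite pairwise_cat => /and3P[/allrelP PQ _ _].
  by apply: PQ; rewrite ?map_f ?mem_head.
have [||m2 rd2 inv2] := IH (rcons P q) m1 _ _ inv1.
- by rewrite size_cat size_rcons; lia.
- by rewrite cat_rcons.
by exists m2; rewrite -?cat_rcons //; apply: reads_cons rd2; exact: ex1.
Qed.

(** The last group is never closed by the program; the answer extends the range of [Q] by [G] in the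
    same way. *)
Lemma range_answer_correct P m :
  {in P, forall q, (0 <= q.1 <= 1)%R} -> invariant P m ->
  ((eval m range_answer)%:R = color_discrepancy P :> R)%R.
Proof.
move=> P01 [Q [G [lr [lb [r [b [u [w [EP last_m cnt _ [Er Eb QR]]]]]]]]]].
(* On the empty stream [Q] and [G] are empty, and any value of [x] serves. *)
have [x [Qx Gx]] : exists x : R,
    {in Q, forall q, (q.1 < x)%R} /\ {in G, forall q, q.1 = x}.
  case: (m last_point) last_m => [x [? ? _]|_ P0]; first by exists x.
  by exists 0%R; move: EP; rewrite P0; case: (Q) (G) => // [[|//]].
have := prefix_range_cat Qx Gx QR; rewrite -EP.
move=> /(color_discrepancy_prefix_range P01) ->.
rewrite /=; case: cnt => -> -> -> -> -> ->.
rewrite -[LHS]/((Posz _)%:~R)%R; congr (_%:~R)%R.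
have -> : total_excess G = ((r + lr)%:Z - (b + lb)%:Z)%R by rewrite Er Eb.
lia.
Qed.

End Algorithm.

Theorem theorem24 (R : realType) :
  exists (s : nat) (A : algorithm s),
    forall P : seq (R * bool),
      (forall q : R * bool, q \in P -> (0 <= q.1 <= 1)%R) ->
      sorted <=%R [seq q.1 | q <- P] ->
      solves A P.
Proof.
exists 9, discrepancy_algorithm => P P01 srt.
have [||m rd inv] := reads_invariant (P := [::])
  (k := counter_bits (size P)) _ _ srt (invariant_init R).
- by rewrite leq_max.
- rewrite cat0s (leq_trans (up_logP _ (isT : 1 < 2))) //.
  by rewrite leq_exp2l // leq_maxr.
exists (eval m range_answer); last exact: range_answer_correct.
by exists m, m; split=> //; exact: exec_skip.
Qed.
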